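(* Let $n\ge 1$, $I_1=(1,\dots,1)\in\mathbb{C}^n$, $v(z)=e^{(z+I_1)\cdot I_1}$ and $f(z)=e^{z\cdot I_1}$ for $z\in\mathbb{C}^n$. Let $h(z)=e^{z\cdot I_1+\overline{z}\cdot I_1}$. Then, on the Fock space $F^2$, $$T_fT_{\overline{v}}=T_h\neq T_{f\overline{v}}.$$
   Context: $dV$ is Lebesgue measure on $\mathbb{C}^n$ and $d\mu(z)=\pi^{-n}e^{-|z|^2}dV(z)$. For $z,w\in\mathbb{C}^n$, $z\cdot w=\sum_k z_kw_k$ (bilinear) and $|z|^2=z\cdot\overline{z}$. $F^2$ is the Fock space of entire functions in $L^2(\mathbb{C}^n,d\mu)$, with reproducing kernel $K_z(w)=e^{w\cdot\overline{z}}$. Toeplitz operators: $T_\varphi=PM_\varphi$, where $M_\varphi$ is multiplication by $\varphi$ and $P$ is the orthogonal projection of $L^2(\mathbb{C}^n,d\mu)$ onto $F^2$; explicitly $T_\varphi F(z)=\int_{\mathbb{C}^n}\varphi(w)F(w)e^{z\cdot\overline{w}}\,d\mu(w)$. Such operators may be unbounded; identities between Toeplitz operators and their products are understood as identities on the (dense) linear span of the kernels $K_z$, $z\in\mathbb{C}^n$, where all the integrals involved converge. *)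

(* Defs.v *)
From HB Require Import structures.
From mathcomp Require Import all_boot all_order all_algebra.
From mathcomp Require Import complex.
From mathcomp Require Import all_classical all_reals all_analysis.
Set Implicit Arguments.
Unset Strict Implicit.
Unset Printing Implicit Defensive.
Import Order.TTheory GRing.Theory Num.Theory.
Import numFieldNormedType.Exports.
Local Open Scope classical_set_scope.
Local Open Scope complex_scope.
Local Open Scope ring_scope.

(* m1 \x m2 under its own name: canonical-structure inference does not find a
   sigma-finite measure on product_measure1 itself. *)
Section sprod.
Context d1 d2 (T1 : measurableType d1) (T2 : measurableType d2) (R : realType).
Variable m1 : {sigma_finite_measure set T1 -> \bar R}.
Variable m2 : {sigma_finite_measure set T2 -> \bar R}.

Definition sprod : set (T1 * T2) -> \bar R := (m1 \x m2)%E.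

HB.instance Definition _ := Measure.on sprod.

Let sprod_sigma_finite : sigma_finite setT sprod.
Proof.
have /sigma_finiteP[F [TF ndF Foo]] := sigma_finiteT m1.
have /sigma_finiteP[G [TG ndG Goo]] := sigma_finiteT m2.
exists (fun n => F n `*` G n).
  rewrite -setXTT TF TG predeqE => -[x y]; split.
    move=> [/= [n _ Fnx] [k _ Gky]]; exists (maxn n k) => //; split.
    - by move: x Fnx; exact/subsetPset/ndF/leq_maxl.
    - by move: y Gky; exact/subsetPset/ndG/leq_maxr.
  by move=> [n _ []/= ? ?]; split; exists n.
move=> k; have [? ?] := Foo k; have [? ?] := Goo k.
split; first exact: measurableX.
by rewrite /sprod product_measure1E// lte_mul_pinfty// ge0_fin_numE.
Qed.

HB.instance Definition _ := Measure_isSigmaFinite.Build _ _ _ sprod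
  sprod_sigma_finite.

End sprod.

Definition tcons {T : Type} {n : nat} (x : T * n.-tuple T) : n.+1.-tuple T :=
  [the n.+1.-tuple T of x.1 :: x.2].

Section push_tcons.
Context d (T : measurableType d) (R : realType) (n : nat).
Variable m : {sigma_finite_measure set (T * n.-tuple T)%type -> \bar R}.

Lemma measurable_tcons : measurable_fun setT (@tcons T n).
Proof. exact: measurable_cons. Qed.

Definition push_tcons : set (n.+1.-tuple T) -> \bar R :=
  pushforward m tcons.

Let push_tcons0 : push_tcons set0 = 0%E.
Proof. by rewrite /push_tcons /pushforward preimage_set0 measure0. Qed.

Let push_tcons_ge0 A : (0 <= push_tcons A)%E.
Proof. by rewrite /push_tcons /pushforward; exact: measure_ge0. Qed.

Let push_tcons_sigma_additive : semi_sigma_additive push_tcons.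
Proof.
move=> F mF tF mUF; rewrite /push_tcons /pushforward preimage_bigcup.
apply: measure_semi_sigma_additive.
- by move=> i; rewrite -[X in measurable X]setTI; exact: measurable_tcons.
- apply/trivIsetP => /= i j _ _ ij; rewrite -preimage_setI.
  by move/trivIsetP : tF => /(_ _ _ _ _ ij) ->//; rewrite preimage_set0.
- rewrite -preimage_bigcup -[X in measurable X]setTI.
  exact: measurable_tcons.
Qed.

HB.instance Definition _ := isMeasure.Build _ _ _ push_tcons
  push_tcons0 push_tcons_ge0 push_tcons_sigma_additive.

Let push_tcons_sigma_finite : sigma_finite setT push_tcons.
Proof.
have [F FT Foo] := sigma_finiteT m.
pose g (t : n.+1.-tuple T) := (tnth t ord0, [tuple of behead t]).
have gK : cancel (@tcons T n) g.
  by case=> x t; rewrite /g /tcons /=; congr (_, _); exact/val_inj.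
have mg : measurable_fun setT g.
  by apply: measurable_fun_pair => /=;
    [exact: measurable_tnth | exact: measurable_behead].
exists (fun i => g @^-1` F i) => [|i].
  by rewrite -preimage_bigcup -FT preimage_setT.
have [mF Fi] := Foo i; split.
  by rewrite -[X in measurable X]setTI; exact: mg.
rewrite /push_tcons /pushforward -comp_preimage (_ : g \o _ = id) ?preimage_id//.
exact/funext.
Qed.

HB.instance Definition _ := Measure_isSigmaFinite.Build _ _ _ push_tcons
  push_tcons_sigma_finite.

End push_tcons.

Section tuple_measure.
Context d (T : measurableType d) (R : realType).
Variable m : {sigma_finite_measure set T -> \bar R}.

Fixpoint tuple_measure (n : nat) :
    {sigma_finite_measure set (n.-tuple T) -> \bar R} :=
  match n with
  | 0%N => \d_([tuple] : 0.-tuple T)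
  | n'.+1 => push_tcons (sprod m (tuple_measure n'))
  end.

End tuple_measure.

Section fock.
Context (R : realType).
Local Notation C := R[i].

Definition plane_lebesgue :
    {sigma_finite_measure set (measurableTypeR R * measurableTypeR R)%type
       -> \bar R} :=
  sprod lebesgue_measure lebesgue_measure.

Definition cexp (z : C) : C :=
  (expR (complex.Re z))%:C * (cos (complex.Im z) +i* sin (complex.Im z)).

Context {n : nat}.
Local Notation Cn := 'rV[C]_n.

(* C^n is identified with (R * R)^n, which carries the product Borel
   sigma-algebra and the n-fold product of planar Lebesgue measure. *)
Definition cvec (t : n.-tuple (measurableTypeR R * measurableTypeR R)) : Cn :=
  \row_k ((tnth t k).1 +i* (tnth t k).2).

Definition dotp (z w : Cn) : C := \sum_k z 0 k * w 0 k.

Definition conjv (z : Cn) : Cn := map_mx conjc z.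

Definition dV := tuple_measure plane_lebesgue n.

Definition gauss_density (z : Cn) : R :=
  (pi ^+ n)^-1 * expR (- complex.Re (dotp z (conjv z))).

(* Integration with respect to the Gaussian measure, gauss_density dV. *)
Definition mu_integral (G : Cn -> C) : C :=
  (\int[dV]_t (complex.Re (G (cvec t)) * gauss_density (cvec t)))
  +i* (\int[dV]_t (complex.Im (G (cvec t)) * gauss_density (cvec t))).

Definition L2mu (G : Cn -> C) : Prop :=
  [/\ measurable_fun setT (fun t => complex.Re (G (cvec t))),
      measurable_fun setT (fun t => complex.Im (G (cvec t))) &
      (\int[dV]_t ((complex.Re (G (cvec t)) ^+ 2 +
                    complex.Im (G (cvec t)) ^+ 2) *
                   gauss_density (cvec t))%:E < +oo)%E].

Definition entire (F : Cn -> C) : Prop :=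
  forall z, differentiable (F : Cn -> C^o) z.

Definition fock (F : Cn -> C) : Prop := entire F /\ L2mu F.

Definition kernel (z : Cn) : Cn -> C := fun w => cexp (dotp w (conjv z)).

Definition kernel_span (F : Cn -> C) : Prop :=
  exists (m : nat) (c : 'I_m -> C) (a : 'I_m -> Cn),
    F = fun w => \sum_i c i * kernel (a i) w.

(* The orthogonal projection of L^2(mu) onto the Fock space, in its explicit
   form G |-> (z |-> <G, K_z>). *)
Definition fock_proj (G : Cn -> C) : Cn -> C :=
  fun z => mu_integral (fun w => G w * cexp (dotp z (conjv w))).

Definition toeplitz (phi F : Cn -> C) : Cn -> C :=
  fock_proj (fun w => phi w * F w).

(* The (maximal) domain of P \o M_phi as an operator in the Fock space.  As
   every K_z is in L^2(mu), the integrals defining toeplitz phi F then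
   converge absolutely. *)
Definition toeplitz_dom (phi F : Cn -> C) : Prop :=
  fock F /\ L2mu (fun w => phi w * F w).

End fock.

(* Main.v *)
(* Writing e_{a,b}(w) = exp(w.a + conj(w).b), all the symbols and all the kernels
   are multiples of such exponentials, products of them are again of this form,
   and everything follows from the Gaussian integral
     int e_{a,b} dmu = exp(a.b).
   It gives T_{e_{p,q}} K_a (z) = exp((p + conj a).(q + z)), so both T_f T_vbar
   and T_h send K_a to exp((conj a + I1).(z + I1)), whereas f vbar = e^n h.
   The Gaussian integral factors, by Fubini, into one-dimensional ones, and these
   reduce to H(b) = int exp(-(x-m)^2) cos(b(x-m)+c) dx, which solves
   H' = -(b/2) H. *)

Require Import Defs.
From HB Require Import structures.
From mathcomp Require Import all_boot all_order all_algebra.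
From mathcomp Require Import complex.
From mathcomp Require Import all_classical all_reals all_analysis.
From mathcomp Require Import measurable_realfun ring lra.
Set Implicit Arguments.
Unset Strict Implicit.
Unset Printing Implicit Defensive.
Import Order.TTheory GRing.Theory Num.Theory.
Import numFieldNormedType.Exports.
Local Open Scope complex_scope.
Local Open Scope ring_scope.

(** * Gaussian integrals on the real line *)

(** A holomorphic symbol acts by multiplication, T_f F = f F, while for an antiholomorphic one the
    kernels are eigenvectors, T_vbar K_a = conj(v(a)) K_a. Hence T_f T_vbar never pairs the exponent
    of f with that of vbar, whereas T_h does and gains the factor exp(I1 . I1) = e^n. The shift by
    I1 in v is there to supply exactly this factor; in the pointwise product f vbar it is then one
    factor too many. The integral of e_{a,b} needs no contour shift: the real part of a linear
    exponent moves the centre m of a real Gaussian, the imaginary part is the frequency b, and the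
    free phase c turns sines into cosines, so that one real differential equation yields both
    components of the complex integral. *)

Section integrable_real.
Local Open Scope classical_set_scope.
Local Open Scope ring_scope.
Context d (T : measurableType d) (R : realType).
Variable mu : {measure set T -> \bar R}.

Lemma integrableRD (f1 f2 : T -> R) :
  mu.-integrable setT (EFin \o f1) -> mu.-integrable setT (EFin \o f2) ->
  mu.-integrable setT (EFin \o (fun t => f1 t + f2 t)).
Proof.
by move=> i1 i2; have := integrableD measurableT i1 i2; apply: eq_integrable.
Qed.

Lemma integrableRZ (k : R) (f : T -> R) : mu.-integrable setT (EFin \o f) ->
  mu.-integrable setT (EFin \o (fun t => k * f t)).
Proof.
by move=> i1; have := integrableZl measurableT k i1; apply: eq_integrable.
Qed.

End integrable_real.

Section real_gauss.
Local Open Scope classical_set_scope.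
Local Open Scope ring_scope.
Context {R : realType}.
Implicit Types m b c x : R.

Local Notation mu := (@lebesgue_measure R).

Definition gaussian m x : R := expR (- (x - m) ^+ 2).

Lemma gaussian_ge0 m x : 0 <= gaussian m x.
Proof. exact: expR_ge0. Qed.

Let sd : R := Num.sqrt (2^-1).

(* [gaussian m] is a multiple of the density of a normal law of variance 1/2. *)
Lemma gaussianE m x : gaussian m x = Num.sqrt pi * normal_pdf m sd x.
Proof.
have sd2 : sd ^+ 2 = 2^-1 by rewrite sqr_sqrtr// invr_ge0.
have sd0 : sd != 0 by rewrite gt_eqF// sqrtr_gt0 invr_gt0.
rewrite normal_pdfE// /normal_peak /normal_fun sd2.
have -> : 2^-1 * pi *+ 2 = pi :> R by rewrite -mulr_natr; field.
have -> : 2^-1 *+ 2 = 1 :> R by rewrite -mulr_natr; field.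
by rewrite divr1 mulrA divff ?mul1r// gt_eqF// sqrtr_gt0 pi_gt0.
Qed.

Lemma integrable_gaussian m : mu.-integrable setT (EFin \o gaussian m).
Proof.
rewrite (funext (gaussianE m)); apply: integrableRZ.
exact: integrable_normal_pdf.
Qed.

Lemma integral_gaussian m : \int[mu]_x gaussian m x = Num.sqrt pi.
Proof.
under eq_Rintegral do rewrite gaussianE.
rewrite RintegralZl//; last exact: integrable_normal_pdf.
by rewrite /Rintegral integral_normal_pdf mulr1.
Qed.

Lemma integrable_dominated (f g : R -> R) :
  measurable_fun setT f -> (forall x, `|f x| <= g x) ->
  mu.-integrable setT (EFin \o g) -> mu.-integrable setT (EFin \o f).
Proof.
move=> mf fg; apply: le_integrable => //; first exact/measurable_EFinP.
move=> x _; rewrite /= lee_fin; apply: le_trans (fg x) _.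
exact: ler_norm.
Qed.

(** The fundamental theorem of calculus on growing symmetric intervals, followed by dominated
    convergence with |f| as majorant. As [f] is integrable, it is enough to control the boundary
    terms along the integers. *)
Lemma integral_derivative_eq0 (F f : R -> R) :
  (forall x, is_derive x 1 F (f x)) -> continuous f ->
  mu.-integrable setT (EFin \o f) ->
  (F n%:R - F (- n%:R)) @[n --> \oo] --> 0 ->
  \int[mu]_x f x = 0.
Proof.
move=> dF cf intf F0.
(* The successor keeps the interval nondegenerate at index 0: the fundamental theorem of calculus
   asks for strictly ordered endpoints. *)
pose A n := `[- n.+1%:R, n.+1%:R]%classic : set R.
have An n : (\int[mu]_(x in A n) (f x)%:E)%E =
            (F n.+1%:R - F (- n.+1%:R))%:E.
  have cF : continuous F.
    move=> x; apply: differentiable_continuous; apply/derivable1_diffP.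
    by have [] := dF x.
  rewrite EFinB; apply: continuous_FTC2.
  - by rewrite -subr_gt0 opprK addr_gt0.
  - exact: continuous_subspaceT.
  - split; first by [].
      exact: cvg_at_right_filter (cF _).
    exact: cvg_at_left_filter (cF _).
  - by move=> x _; rewrite derive1E; exact: derive_val.
have dom : ((\int[mu]_(x in A n) (f x)%:E)%E @[n --> \oo] -->
            (\int[mu]_x (f x)%:E)%E)%classic.
  rewrite (_ : (fun n => _) =
    (fun n => (\int[mu]_x (((EFin \o f) \_ (A n)) x))%E)); last first.
    by apply/funext => n; rewrite integral_mkcond.
  apply: (@dominated_cvg _ _ _ mu _ _ _ _ (abse \o (EFin \o f))) => //.
  - move=> n; apply/(measurable_restrictT _ _).1; first exact: measurable_itv.
    by apply: measurable_funTS; exact: measurable_int intf.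
  - move=> x _; apply: cvg_near_cst.
    exists (Num.truncn `|x|) => // n /= xn.
    rewrite patchE ifT// inE /A /= in_itv /= -ler_norml.
    rewrite (le_trans (ltW (truncnS_gt _)))// ler_nat.
    by rewrite ltnS.
  - exact: integrable_abse.
  - move=> n x _ /=; rewrite patchE; case: ifP => // _.
    by rewrite abse0 lee_fin normr_ge0.
have lim0 : ((\int[mu]_(x in A n) (f x)%:E)%E @[n --> \oo] --> 0%E)%classic.
  under eq_fun do rewrite An.
  apply: cvg_EFin; first exact: nearW.
  by rewrite -(cvg_shiftS (fun n => F n%:R - F (- n%:R))) in F0.
by rewrite /Rintegral -(cvg_lim _ dom)// (cvg_lim _ lim0).
Qed.

(* |t| exp(-t^2) is dominated by exp(-t^2) (exp t + exp(-t)), a sum of shifted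
   Gaussians. *)
Lemma normr_mul_gaussian_le m x :
  `|x - m| * gaussian m x <= expR 4^-1 * (gaussian (m + 2^-1) x + gaussian (m - 2^-1) x).
Proof.
have le_exp : `|x - m| <= expR (x - m) + expR (m - x).
  have e1 := expR_ge1Dx (x - m); have e2 := expR_ge1Dx (m - x).
  have p1 := expR_ge0 (x - m); have p2 := expR_ge0 (m - x).
  by rewrite ler_norml; apply/andP; split; lra.
apply: (le_trans (ler_wpM2r (gaussian_ge0 m x) le_exp)).
(* With t = x - m, completing the square gives t - t^2 = 1/4 - (t - 1/2)^2 and its mirror image,
   hence the centres m + 1/2 and m - 1/2 and the factor exp(1/4). *)
rewrite mulrDl mulrDr /gaussian -!expRD le_eqVlt; apply/orP; left; apply/eqP.
by congr (expR _ + expR _); field.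
Qed.

Lemma is_derive_gaussian m x :
  is_derive x 1 (gaussian m) (- (2 * (x - m)) * gaussian m x).
Proof.
by apply: is_derive_eq; rewrite /GRing.scale /= /gaussian; ring.
Qed.

Lemma is_derive_gaussian_sin m b c x :
  is_derive x 1 (fun t => gaussian m t * sin (b * (t - m) + c))
    (- (2 * (x - m)) * gaussian m x * sin (b * (x - m) + c) +
     b * (gaussian m x * cos (b * (x - m) + c))).
Proof.
have := is_derive_gaussian m x => ?.
by apply: is_derive_eq; rewrite /GRing.scale /=; ring.
Qed.

Lemma is_derive_gaussian_cos m b c x :
  is_derive b 1 (fun s => gaussian m x * cos (s * (x - m) + c))
    (- ((x - m) * gaussian m x * sin (b * (x - m) + c))).
Proof. by apply: is_derive_eq; rewrite /GRing.scale /=; ring. Qed.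

Lemma continuous_gaussian_trig (g : R -> R) m b c :
  continuous g -> continuous (fun x => gaussian m x * g (b * (x - m) + c)).
Proof.
move=> cg x; apply: cvgM.
  have := is_derive_gaussian m x => -[dg _].
  by apply: differentiable_continuous; apply/derivable1_diffP.
apply: (cvg_comp (fun x => b * (x - m) + c) g); last exact: cg.
apply: cvgD; last exact: cvg_cst.
apply: cvgM; first exact: cvg_cst.
by apply: cvgB; [exact: cvg_id | exact: cvg_cst].
Qed.

Lemma continuous_mul_gaussian_trig (g : R -> R) m b c : continuous g ->
  continuous (fun x => (x - m) * gaussian m x * g (b * (x - m) + c)).
Proof.
move=> cg x; under eq_fun do rewrite -mulrA.
apply: cvgM; last exact: continuous_gaussian_trig.
by apply: cvgB; [exact: cvg_id | exact: cvg_cst].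
Qed.

Lemma integrable_gaussian_trig (g : R -> R) m b c :
  continuous g -> (forall x, `|g x| <= 1) ->
  mu.-integrable setT (EFin \o (fun x => gaussian m x * g (b * (x - m) + c))).
Proof.
move=> cg g1; apply: (integrable_dominated (g := gaussian m)).
- by apply: continuous_measurable_fun; exact: continuous_gaussian_trig.
- by move=> x; rewrite normrM ger0_norm ?gaussian_ge0// ler_piMr ?gaussian_ge0.
- exact: integrable_gaussian.
Qed.

(** This majorant involves neither the frequency [b] nor the phase [c], so it serves uniformly when
    differentiating in [b] under the integral sign. *)
Definition gaussian_bound m x : R :=
  expR 4^-1 * (gaussian (m + 2^-1) x + gaussian (m - 2^-1) x).

Lemma integrable_gaussian_bound m : mu.-integrable setT (EFin \o gaussian_bound m).
Proof.
apply: integrableRZ; apply: integrableRD; exact: integrable_gaussian.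
Qed.

Lemma normr_mul_gaussian_trig (g : R -> R) m x y : `|g y| <= 1 ->
  `|(x - m) * gaussian m x * g y| <= gaussian_bound m x.
Proof.
move=> g1; rewrite !normrM (ger0_norm (gaussian_ge0 _ _)).
apply: le_trans (normr_mul_gaussian_le m x).
by rewrite ler_piMr// mulr_ge0 ?gaussian_ge0.
Qed.

Lemma integrable_mul_gaussian_trig (g : R -> R) m b c :
  continuous g -> (forall x, `|g x| <= 1) ->
  mu.-integrable setT
    (EFin \o (fun x => (x - m) * gaussian m x * g (b * (x - m) + c))).
Proof.
move=> cg g1; apply: (integrable_dominated (g := gaussian_bound m)).
- by apply: continuous_measurable_fun; exact: continuous_mul_gaussian_trig.
- by move=> x; exact: normr_mul_gaussian_trig.
- exact: integrable_gaussian_bound.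
Qed.

Lemma normr_sin_le1 x : `|sin x| <= 1.
Proof. by rewrite ler_norml sin_geN1 sin_le1. Qed.

Lemma normr_cos_le1 x : `|cos x| <= 1.
Proof. by rewrite ler_norml cos_geN1 cos_le1. Qed.

Lemma cvg_gaussian_nat m : gaussian m n%:R @[n --> \oo] --> 0.
Proof.
apply: (cvg_comp (fun n : nat => n%:R - m) gauss_fun _ cvg_gauss_fun).
apply: cvg_comp (cvg_addrr _); exact: cvgr_idn.
Qed.

(** Integration by parts: the derivative of the Gaussian times the sine integrates to zero, because
    the Gaussian vanishes at both ends. *)
Lemma integral_mul_gaussian_sin m b c :
  \int[mu]_x ((x - m) * gaussian m x * sin (b * (x - m) + c)) =
  b / 2 * \int[mu]_x (gaussian m x * cos (b * (x - m) + c)).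
Proof.
have is1 := integrable_mul_gaussian_trig m b c (@continuous_sin R) normr_sin_le1.
have is2 := integrable_gaussian_trig m b c (@continuous_cos R) normr_cos_le1.
have := @integral_derivative_eq0 _ _ (is_derive_gaussian_sin m b c).
have -> : (fun x => - (2 * (x - m)) * gaussian m x * sin (b * (x - m) + c) +
     b * (gaussian m x * cos (b * (x - m) + c))) =
  (fun x => -2 * ((x - m) * gaussian m x * sin (b * (x - m) + c)) +
     b * (gaussian m x * cos (b * (x - m) + c))).
  by apply/funext => x; congr (_ + _); ring.
rewrite RintegralD// ?RintegralZl//; first last.
- exact: integrableRZ.
- exact: integrableRZ.
move=> H; suff : -2 * \int[mu]_x ((x - m) * gaussian m x * sin (b * (x - m) + c)) +
   b * \int[mu]_x (gaussian m x * cos (b * (x - m) + c)) = 0 by lra.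
apply: H.
- move=> x; apply: cvgD; (apply: cvgM; first exact: cvg_cst).
    by apply: continuous_mul_gaussian_trig; exact: continuous_sin.
  by apply: continuous_gaussian_trig; exact: continuous_cos.
- exact: integrableRD (integrableRZ (-2) is1) (integrableRZ b is2).
- have lim (u : nat -> R) (v : nat -> R) : u n @[n --> \oo] --> 0 ->
      (forall n, `|v n| <= u n) -> v n @[n --> \oo] --> 0.
    move=> u0 vu; apply/norm_cvg0P; apply: (squeeze_cvgr (f := cst 0) _ _ u0).
      by apply: nearW => n; rewrite /= normr_ge0 vu.
    exact: cvg_cst.
  rewrite -(subr0 0); apply: cvgB.
    apply: lim (cvg_gaussian_nat m) _ => n.
    by rewrite normrM ger0_norm ?gaussian_ge0// ler_piMr ?gaussian_ge0 ?normr_sin_le1.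
  apply: lim (cvg_gaussian_nat (- m)) _ => n.
  rewrite normrM ger0_norm ?gaussian_ge0//.
  (* Reflection turns the limit at minus infinity into one at plus infinity, for the Gaussian
     centred at [- m]. *)
  have -> : gaussian m (- n%:R) = gaussian (- m) n%:R.
    by rewrite /gaussian; congr (expR (- _)); ring.
  by rewrite ler_piMr ?gaussian_ge0 ?normr_sin_le1.
Qed.

(** Differentiating the cosine under the integral brings out x - m, and the integration by parts
    above turns the resulting sine integral back into the original one. *)
Lemma is_derive_integral_gaussian_cos m b c :
  is_derive b 1 (fun s => \int[mu]_x (gaussian m x * cos (s * (x - m) + c)))
    (- (b / 2) * \int[mu]_x (gaussian m x * cos (b * (x - m) + c))).
Proof.
pose f s x := gaussian m x * cos (s * (x - m) + c).
(* Any open interval around [b] would do, since the majorant does not depend on [s]. *)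
have bI : `]b - 1, b + 1[%classic b by rewrite /= in_itv /=; apply/andP; split; lra.
have intf s : `]b - 1, b + 1[%classic s -> mu.-integrable setT (EFin \o f s).
  move=> _; apply: integrable_gaussian_trig; last exact: normr_cos_le1.
  exact: continuous_cos.
have df s x : `]b - 1, b + 1[%classic s -> setT x -> derivable (f^~ x) s 1.
  by move=> _ _; have [] := is_derive_gaussian_cos m s c x.
have f'E s x : partial1of2 f s x =
    - ((x - m) * gaussian m x * sin (s * (x - m) + c)).
  by rewrite partial1of2E; have [_] := is_derive_gaussian_cos m s c x.
have f'le s x : `]b - 1, b + 1[%classic s -> setT x ->
    `|partial1of2 f s x| <= gaussian_bound m x.
  move=> _ _; rewrite f'E normrN; apply: normr_mul_gaussian_trig.
  exact: normr_sin_le1.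
have G0 x : 0 <= gaussian_bound m x.
  by rewrite mulr_ge0 ?expR_ge0// addr_ge0 ?gaussian_ge0.
have intG := integrable_gaussian_bound m.
split.
  exact: (derivable_under_integral measurableT bI intf df G0 intG f'le).
rewrite -derive1E.
rewrite (differentiation_under_integral measurableT bI intf df G0 intG f'le).
under eq_Rintegral do rewrite f'E -mulN1r.
rewrite RintegralZl//; last first.
  by apply: integrable_mul_gaussian_trig; [exact: continuous_sin | exact: normr_sin_le1].
by rewrite integral_mul_gaussian_sin mulN1r mulNr.
Qed.

Lemma integral_gaussian_cos m b c :
  \int[mu]_x (gaussian m x * cos (b * (x - m) + c)) =
  Num.sqrt pi * expR (- b ^+ 2 / 4) * cos c.
Proof.
pose H s := \int[mu]_x (gaussian m x * cos (s * (x - m) + c)).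
have H0 : H 0 = Num.sqrt pi * cos c.
  rewrite /H; under eq_Rintegral do rewrite mul0r add0r.
  by rewrite RintegralZr ?integral_gaussian//; exact: integrable_gaussian.
have dH (s : R) : is_derive s 1 H (- (s / 2) * H s).
  exact: is_derive_integral_gaussian_cos.
(* exp(t^2/4) is the integrating factor of H' = -(t/2) H, so this product is constant and equal to
   H(0). *)
have dK (s : R) : is_derive s 1 (fun t => H t * expR (t ^+ 2 / 4)) 0.
  by have := dH s => ?; apply: is_derive_eq; rewrite /GRing.scale /=; field.
have := is_derive_0_is_cst b 0 dK.
rewrite H0 expr0n mul0r expR0 mulr1 => HE.
rewrite -/(H b) mulrAC -HE -mulrA -expRD.
by rewrite mulNr subrr expR0 mulr1.
Qed.

End real_gauss.

(** * Complex integrals and Fubini for products *)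

Lemma complex_ext (R : realType) (x y : R[i]) :
  complex.Re x = complex.Re y -> complex.Im x = complex.Im y -> x = y.
Proof. by case: x y => [a b] [u v] /= -> ->. Qed.

Section complex_integral.
Local Open Scope classical_set_scope.
Local Open Scope ring_scope.
Context d (T : measurableType d) (R : realType).
Variable mu : {measure set T -> \bar R}.
Implicit Types g : T -> R[i].

Definition cintegrable g :=
  mu.-integrable setT (EFin \o (fun t => complex.Re (g t))) /\
  mu.-integrable setT (EFin \o (fun t => complex.Im (g t))).

Definition cint g : R[i] :=
  (\int[mu]_t complex.Re (g t)) +i* (\int[mu]_t complex.Im (g t)).

Lemma cintegrableD g1 g2 : cintegrable g1 -> cintegrable g2 ->
  cintegrable (fun t => g1 t + g2 t).
Proof.
move=> [r1 i1] [r2 i2]; split.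
  have := integrableRD r1 r2; apply: eq_integrable => // t _ /=.
  by case: (g1 t) (g2 t) => [a b] [? ?].
have := integrableRD i1 i2; apply: eq_integrable => // t _ /=.
by case: (g1 t) (g2 t) => [a b] [? ?].
Qed.

Lemma cintD g1 g2 : cintegrable g1 -> cintegrable g2 ->
  cint (fun t => g1 t + g2 t) = cint g1 + cint g2.
Proof.
move=> [r1 i1] [r2 i2]; rewrite /cint.
apply: complex_ext => /=.
  rewrite -RintegralD//; apply: eq_Rintegral => t _.
  by case: (g1 t) (g2 t) => [a b] [? ?].
rewrite -RintegralD//; apply: eq_Rintegral => t _.
by case: (g1 t) (g2 t) => [a b] [? ?].
Qed.

(** The difference is written with [+ - 1 *] so that additivity and scaling of real integrals apply
    directly. *)
Lemma ReM (x y : R[i]) : complex.Re (x * y) =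
  complex.Re x * complex.Re y + - 1 * (complex.Im x * complex.Im y).
Proof. by case: x y => [a b] [u v] /=; rewrite mulN1r. Qed.

Lemma ImM (x y : R[i]) : complex.Im (x * y) =
  complex.Re x * complex.Im y + complex.Im x * complex.Re y.
Proof. by case: x y => [a b] [u v] /=. Qed.

Lemma cintegrableZ (k : R[i]) g : cintegrable g ->
  cintegrable (fun t => k * g t).
Proof.
move=> [r1 i1]; split.
  under eq_fun do rewrite ReM; apply: integrableRD; first exact: integrableRZ.
  by apply: integrableRZ; exact: integrableRZ.
by under eq_fun do rewrite ImM; apply: integrableRD; exact: integrableRZ.
Qed.

Lemma cintZ (k : R[i]) g : cintegrable g ->
  cint (fun t => k * g t) = k * cint g.
Proof.
move=> [r1 i1]; rewrite /cint.
apply: complex_ext; rewrite ?ReM ?ImM /=.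
  under eq_Rintegral do rewrite ReM.
  rewrite RintegralD//; [|exact: integrableRZ|by do 2!apply: integrableRZ].
  rewrite RintegralZl// RintegralZl//; last exact: integrableRZ.
  by rewrite RintegralZl.
under eq_Rintegral do rewrite ImM.
rewrite RintegralD//; [|exact: integrableRZ|exact: integrableRZ].
by rewrite RintegralZl// RintegralZl.
Qed.

Lemma cint0 : cintegrable (fun=> 0) /\ cint (fun=> 0) = 0.
Proof.
split; first by split; exact: integrable0.
by rewrite /cint /= !Rintegral_cst// !mul0r.
Qed.

Lemma cintegrable_sum (I : Type) (s : seq I) (g : I -> T -> R[i]) :
  (forall i, cintegrable (g i)) -> cintegrable (fun t => \sum_(i <- s) g i t).
Proof.
move=> ig; elim: s => [|i s IH].
  by under [X in cintegrable X]eq_fun do rewrite big_nil; exact: cint0.1.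
by under [X in cintegrable X]eq_fun do rewrite big_cons; exact: cintegrableD.
Qed.

Lemma cint_sum (I : Type) (s : seq I) (g : I -> T -> R[i]) :
  (forall i, cintegrable (g i)) ->
  cint (fun t => \sum_(i <- s) g i t) = \sum_(i <- s) cint (g i).
Proof.
move=> ig; elim: s => [|i s IH].
  by under [X in cint X]eq_fun do rewrite big_nil; rewrite cint0.2 big_nil.
under [X in cint X]eq_fun do rewrite big_cons.
by rewrite cintD ?IH ?big_cons//; exact: cintegrable_sum.
Qed.

End complex_integral.

Section complex_fubini.
Local Open Scope classical_set_scope.
Local Open Scope ring_scope.
Context d1 d2 (T1 : measurableType d1) (T2 : measurableType d2) (R : realType).
Variable m1 : {sigma_finite_measure set T1 -> \bar R}.
Variable m2 : {sigma_finite_measure set T2 -> \bar R}.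

Section real.
Variables (f : T1 -> R) (g : T2 -> R).
Hypothesis intf : m1.-integrable setT (EFin \o f).
Hypothesis intg : m2.-integrable setT (EFin \o g).

(** Tonelli on absolute values: the iterated integral of |f(x) g(y)| is a product of two finite
    integrals. *)
Lemma integrable_prod :
  (sprod m1 m2).-integrable setT (EFin \o (fun z => f z.1 * g z.2)).
Proof.
have /measurable_EFinP mf := measurable_int _ intf.
have /measurable_EFinP mg := measurable_int _ intg.
have mfg : measurable_fun setT (EFin \o (fun z : T1 * T2 => f z.1 * g z.2)).
  apply/measurable_EFinP; apply: measurable_funM.
    exact: (measurableT_comp mf).
  exact: (measurableT_comp mg).
apply/(integrable12ltyP _ _ mfg) => /=.
under eq_integral => x _.
  under eq_integral do rewrite /= normrM EFinM.
  rewrite integralZl//; last exact: integrable_abse intg.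
  over.
(* Exhibiting the inner integral as a real number lets it be pulled out as a scalar. *)
have /fineK <- : (\int[m2]_y `|g y|%:E)%E \is a fin_num.
  by apply: integrable_fin_num => //; exact: integrable_abse intg.
rewrite integralZr//; last exact: integrable_abse intf.
rewrite ltey_eq fin_numM//.
by apply: integrable_fin_num => //; exact: integrable_abse intf.
Qed.

Lemma Rintegral_prod : \int[sprod m1 m2]_z (f z.1 * g z.2) =
  (\int[m1]_x f x) * (\int[m2]_y g y).
Proof.
rewrite {1}/Rintegral -(integral12_prod_meas1 integrable_prod) /fubini_F /=.
under eq_integral => x _.
  under eq_integral do rewrite EFinM.
  rewrite integralZl//.
  over.
have /fineK <- : (\int[m2]_y (g y)%:E)%E \is a fin_num.
  exact: integrable_fin_num.
by rewrite integralZr// fineM//; exact: integrable_fin_num.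
Qed.

End real.

Variables (f : T1 -> R[i]) (g : T2 -> R[i]).
Hypothesis intf : cintegrable m1 f.
Hypothesis intg : cintegrable m2 g.

Lemma cintegrable_prod : cintegrable (sprod m1 m2) (fun z => f z.1 * g z.2).
Proof.
have [rf jf] := intf; have [rg jg] := intg; split.
  under eq_fun do rewrite ReM; apply: integrableRD; last apply: integrableRZ.
    exact: (integrable_prod rf rg).
  exact: (integrable_prod jf jg).
under eq_fun do rewrite ImM; apply: integrableRD.
  exact: (integrable_prod rf jg).
exact: (integrable_prod jf rg).
Qed.

Lemma cint_prod : cint (sprod m1 m2) (fun z => f z.1 * g z.2) =
  cint m1 f * cint m2 g.
Proof.
have [rf jf] := intf; have [rg jg] := intg; rewrite /cint.
apply: complex_ext; rewrite ?ReM ?ImM /=.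
  under [LHS]eq_Rintegral do rewrite ReM.
  rewrite RintegralD//; last 2 first.
  - exact: (integrable_prod rf rg).
  - by apply: integrableRZ; exact: (integrable_prod jf jg).
  rewrite RintegralZl//; last exact: (integrable_prod jf jg).
  by rewrite (Rintegral_prod rf rg) (Rintegral_prod jf jg).
under [LHS]eq_Rintegral do rewrite ImM.
rewrite RintegralD//; last 2 first.
- exact: (integrable_prod rf jg).
- exact: (integrable_prod jf rg).
by rewrite (Rintegral_prod rf jg) (Rintegral_prod jf rg).
Qed.

End complex_fubini.

(** * Complex Gaussian integrals *)

Section cexp_theory.
Context {R : realType}.
Implicit Types x y : R[i].

Lemma cexpD x y : cexp (x + y) = cexp x * cexp y.
Proof.
case: x y => [a b] [u v]; rewrite /cexp /= expRD cosD sinD.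
by apply: complex_ext => /=; ring.
Qed.

Lemma cexp0 : cexp 0 = 1 :> R[i].
Proof.
by rewrite /cexp /= expR0 cos0 sin0; apply: complex_ext => /=; ring.
Qed.

Lemma conjc_cexp x : conjc (cexp x) = cexp (conjc x).
Proof.
case: x => [a b]; rewrite /cexp /= cosN sinN.
by apply: complex_ext => /=; ring.
Qed.

Lemma cexpE (a b : R) : cexp (a +i* b) = (expR a * cos b) +i* (expR a * sin b).
Proof.
by rewrite /cexp /=; apply: complex_ext => /=; ring.
Qed.

End cexp_theory.

(** * Complex exponentials against the Gaussian weight in one real variable *)

Section gaussian_line.
Local Open Scope classical_set_scope.
Local Open Scope ring_scope.
Context {R : realType}.
Local Notation mu := (@lebesgue_measure R).

(** Normalized by the square root of pi so that two copies multiply to the density of the planar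
    Gaussian measure. *)
Definition line_weight (x : R) : R := (Num.sqrt pi)^-1 * expR (- x ^+ 2).

(** Completing the square, a x - x^2 = a^2/4 - (x - a/2)^2; the phase b x is recentred at a/2
    accordingly, which leaves a b/2. *)
Lemma Re_cexp_line (a b x : R) :
  complex.Re (cexp ((a +i* b) * x%:C) * (line_weight x)%:C) =
  (Num.sqrt pi)^-1 * expR (a ^+ 2 / 4) *
    (gaussian (a / 2) x * cos (b * (x - a / 2) + a * b / 2)).
Proof.
have -> : (a +i* b) * x%:C = (a * x) +i* (b * x).
  by apply: complex_ext => /=; ring.
rewrite cexpE /= /line_weight /gaussian.
have -> : b * (x - a / 2) + a * b / 2 = b * x by field.
rewrite [RHS]mulrA -(mulrA (_^-1) (expR _)) -expRD.
have -> : a ^+ 2 / 4 + - (x - a / 2) ^+ 2 = a * x - x ^+ 2 by field.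
by rewrite expRD; ring.
Qed.

Lemma Im_cexp_line (a b x : R) :
  complex.Im (cexp ((a +i* b) * x%:C) * (line_weight x)%:C) =
  (Num.sqrt pi)^-1 * expR (a ^+ 2 / 4) *
    (gaussian (a / 2) x * cos (b * (x - a / 2) + (a * b / 2 - pi / 2))).
Proof.
have -> : (a +i* b) * x%:C = (a * x) +i* (b * x).
  by apply: complex_ext => /=; ring.
rewrite cexpE /= /line_weight /gaussian.
have -> : b * (x - a / 2) + (a * b / 2 - pi / 2) = b * x - pi / 2 by field.
rewrite cosBpihalf.
rewrite [RHS]mulrA -(mulrA (_^-1) (expR _)) -expRD.
have -> : a ^+ 2 / 4 + - (x - a / 2) ^+ 2 = a * x - x ^+ 2 by field.
by rewrite expRD; ring.
Qed.

Lemma cintegrable_line (s : R[i]) :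
  cintegrable mu (fun x => cexp (s * x%:C) * (line_weight x)%:C).
Proof.
case: s => a b; split.
  under eq_fun do rewrite Re_cexp_line; apply: integrableRZ.
  by apply: integrable_gaussian_trig; [exact: continuous_cos | exact: normr_cos_le1].
under eq_fun do rewrite Im_cexp_line; apply: integrableRZ.
by apply: integrable_gaussian_trig; [exact: continuous_cos | exact: normr_cos_le1].
Qed.

(** For s = a + ib, the factor exp(a^2/4) of the completed square and exp(-b^2/4) of the oscillation
    combine to exp(Re(s^2/4)), and the remaining phase a b/2 is Im(s^2/4). *)
Lemma cint_line (s : R[i]) :
  cint mu (fun x => cexp (s * x%:C) * (line_weight x)%:C) = cexp (s ^+ 2 / 4).
Proof.
have sp0 : Num.sqrt pi != 0 :> R by rewrite gt_eqF// sqrtr_gt0 pi_gt0.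
have ic (a b c : R) : mu.-integrable setT
    (EFin \o (fun x => gaussian (a / 2) x * cos (b * (x - a / 2) + c))).
  by apply: integrable_gaussian_trig; [exact: continuous_cos | exact: normr_cos_le1].
case: s => a b; rewrite /cint.
have -> : (a +i* b) ^+ 2 / 4 = ((a ^+ 2 - b ^+ 2) / 4) +i* (a * b / 2).
  apply: (@mulIf _ 4); first by rewrite pnatr_eq0.
  rewrite divfK ?pnatr_eq0//.
  have -> : 4 = 4 +i* 0 :> R[i].
    by rewrite -[RHS]/(4%:C) rmorph_nat.
  by apply: complex_ext => /=; field.
under eq_Rintegral do rewrite Re_cexp_line.
under [X in _ +i* X]eq_Rintegral do rewrite Im_cexp_line.
rewrite !RintegralZl// !integral_gaussian_cos cexpE.
rewrite cosBpihalf.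
have -> : (a ^+ 2 - b ^+ 2) / 4 = a ^+ 2 / 4 + (- b ^+ 2 / 4) by field.
rewrite (expRD (a ^+ 2 / 4)).
by apply: complex_ext => /=; field.
Qed.

End gaussian_line.

(** * The exponential integral over one complex variable *)

Section gaussian_plane.
Local Open Scope classical_set_scope.
Local Open Scope ring_scope.
Context {R : realType}.

Definition plane_exp (a b : R[i]) (p : R * R) : R[i] :=
  cexp (a * (p.1 +i* p.2) + b * (p.1 -i* p.2)) *
  (pi^-1 * expR (- (p.1 ^+ 2 + p.2 ^+ 2)))%:C.

(** The identity a(x + iy) + b(x - iy) = (a + b)x + i(a - b)y separates the real variables. *)
Lemma plane_expE a b p : plane_exp a b p =
  (cexp ((a + b) * p.1%:C) * (line_weight p.1)%:C) *
  (cexp ('i * (a - b) * p.2%:C) * (line_weight p.2)%:C).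
Proof.
case: p => x y; rewrite /plane_exp /=.
rewrite mulrACA -cexpD -rmorphM /=; congr (cexp _ * _%:C).
  by case: a b => [a a'] [b b']; apply: complex_ext => /=; ring.
rewrite /line_weight mulrACA -invfM -expr2 sqr_sqrtr ?pi_ge0// -expRD.
by rewrite opprD.
Qed.

Lemma cintegrable_plane a b : cintegrable (plane_lebesgue R) (plane_exp a b).
Proof.
rewrite (funext (plane_expE a b)).
exact: cintegrable_prod (cintegrable_line _) (cintegrable_line _).
Qed.

(** Polarization: the one-dimensional exponents add up to ((a + b)^2 - (a - b)^2)/4 = ab. *)
Lemma cint_plane a b : cint (plane_lebesgue R) (plane_exp a b) = cexp (a * b).
Proof.
rewrite (funext (plane_expE a b)).
rewrite (cint_prod (cintegrable_line _) (cintegrable_line _)).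
rewrite !cint_line -cexpD; congr cexp.
have -> : ('i * (a - b)) ^+ 2 = - (a - b) ^+ 2.
  by rewrite exprMn sqr_i mulN1r.
by field.
Qed.

End gaussian_plane.

(** * Measurability of complex-valued functions *)

Section complex_measurable.
Local Open Scope classical_set_scope.
Local Open Scope ring_scope.
Context d (T : measurableType d) (R : realType).
Implicit Types g : T -> R[i].

Definition cmeasurable g :=
  measurable_fun setT (fun t => complex.Re (g t)) /\
  measurable_fun setT (fun t => complex.Im (g t)).

Lemma cmeasurable_cst (c : R[i]) : cmeasurable (fun=> c).
Proof. by split; exact: measurable_cst. Qed.

Lemma cmeasurableD g1 g2 : cmeasurable g1 -> cmeasurable g2 ->
  cmeasurable (fun t => g1 t + g2 t).
Proof.
move=> [r1 i1] [r2 i2]; split.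
  rewrite [X in measurable_fun _ X](_ : _ =
    (fun t => complex.Re (g1 t) + complex.Re (g2 t))); first exact: measurable_funD.
  by apply/funext => t; case: (g1 t) (g2 t) => [? ?] [? ?].
rewrite [X in measurable_fun _ X](_ : _ =
  (fun t => complex.Im (g1 t) + complex.Im (g2 t))); first exact: measurable_funD.
by apply/funext => t; case: (g1 t) (g2 t) => [? ?] [? ?].
Qed.

Lemma cmeasurableM g1 g2 : cmeasurable g1 -> cmeasurable g2 ->
  cmeasurable (fun t => g1 t * g2 t).
Proof.
move=> [r1 i1] [r2 i2]; split.
  under eq_fun do rewrite ReM.
  apply: measurable_funD; first exact: measurable_funM.
  by apply: measurable_funM => //; exact: measurable_funM.
under eq_fun do rewrite ImM.
by apply: measurable_funD; exact: measurable_funM.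
Qed.

Lemma cmeasurable_sum (I : Type) (s : seq I) (g : I -> T -> R[i]) :
  (forall i, cmeasurable (g i)) -> cmeasurable (fun t => \sum_(i <- s) g i t).
Proof.
move=> mg; elim: s => [|i s IH].
  by under [X in cmeasurable X]eq_fun do rewrite big_nil; exact: cmeasurable_cst.
by under [X in cmeasurable X]eq_fun do rewrite big_cons; exact: cmeasurableD.
Qed.

Lemma cmeasurable_cexp g : cmeasurable g -> cmeasurable (fun t => cexp (g t)).
Proof.
move=> [mr mi]; apply: cmeasurableM; split => //=.
- exact: (measurableT_comp (@measurable_expR R)).
- apply: (measurableT_comp _ mi).
  by apply: continuous_measurable_fun; exact: continuous_cos.
- apply: (measurableT_comp _ mi).
  by apply: continuous_measurable_fun; exact: continuous_sin.
Qed.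

Lemma cmeasurable_conjc g : cmeasurable g -> cmeasurable (fun t => conjc (g t)).
Proof.
move=> [mr mi]; split.
  by rewrite [X in measurable_fun _ X](_ : _ = (fun t => complex.Re (g t)));
    [|apply/funext => t; case: (g t)].
rewrite [X in measurable_fun _ X](_ : _ = (fun t => - complex.Im (g t))).
  exact: measurableT_comp.
by apply/funext => t; case: (g t).
Qed.

End complex_measurable.

(** * The exponential integral in dimension n *)

Section gaussian_space.
Local Open Scope classical_set_scope.
Local Open Scope ring_scope.
Context {R : realType}.
Local Notation C := R[i].

Definition gexp n (a b w : 'rV[C]_n) : C := cexp (dotp w a + dotp (conjv w) b).

Lemma cmeasurable_cvec n (k : 'I_n) :
  cmeasurable (fun t => cvec t 0 k : C).
Proof.
split; under eq_fun do rewrite mxE /=.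
  exact: (measurableT_comp (@measurable_fst _ _ _ _) (measurable_tnth k)).
exact: (measurableT_comp (@measurable_snd _ _ _ _) (measurable_tnth k)).
Qed.

Lemma cmeasurable_gexp n (a b : 'rV[C]_n) :
  cmeasurable (fun t => gexp a b (cvec t)).
Proof.
apply/cmeasurable_cexp/cmeasurableD; apply: cmeasurable_sum => k.
  by apply: cmeasurableM; [exact: cmeasurable_cvec|exact: cmeasurable_cst].
apply: cmeasurableM; last exact: cmeasurable_cst.
under [X in cmeasurable X]eq_fun do rewrite mxE.
by apply: cmeasurable_conjc; exact: cmeasurable_cvec.
Qed.

Lemma cmeasurable_density n :
  cmeasurable (fun t => (gauss_density (cvec t : 'rV[C]_n))%:C).
Proof.
split; last exact: measurable_cst.
rewrite /= /gauss_density; apply: measurable_funM => //.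
apply: measurableT_comp => //.
suff [] : cmeasurable (fun t => - dotp (cvec t : 'rV[C]_n) (conjv (cvec t))).
  move=> mr _; rewrite [X in measurable_fun _ X](_ : _ = (fun t =>
    complex.Re (- dotp (cvec t : 'rV[C]_n) (conjv (cvec t)))))//.
  by apply/funext => t; case: (dotp _ _).
under [X in cmeasurable X]eq_fun do rewrite -mulN1r.
apply: cmeasurableM; first exact: cmeasurable_cst.
apply: cmeasurable_sum => k; apply: cmeasurableM; first exact: cmeasurable_cvec.
under [X in cmeasurable X]eq_fun do rewrite mxE.
by apply: cmeasurable_conjc; exact: cmeasurable_cvec.
Qed.

Definition gexp_weighted n (a b : 'rV[C]_n)
    (t : n.-tuple (measurableTypeR R * measurableTypeR R)) : C :=
  gexp a b (cvec t) * (gauss_density (cvec t))%:C.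

Lemma cmeasurable_gexp_weighted n (a b : 'rV[C]_n) :
  cmeasurable (gexp_weighted a b).
Proof.
by apply: cmeasurableM; [exact: cmeasurable_gexp|exact: cmeasurable_density].
Qed.

Definition behead_rv n (a : 'rV[C]_n.+1) : 'rV[C]_n := \row_k a 0 (lift ord0 k).

Lemma dotp_recl n (a b : 'rV[C]_n.+1) :
  dotp a b = a 0 0 * b 0 0 + dotp (behead_rv a) (behead_rv b).
Proof.
by rewrite /dotp big_ord_recl; congr (_ + _); apply: eq_bigr => k _; rewrite !mxE.
Qed.

Lemma behead_conjv n (a : 'rV[C]_n.+1) : behead_rv (conjv a) = conjv (behead_rv a).
Proof. by apply/rowP => k; rewrite !mxE. Qed.

Lemma behead_cvec_tcons n (z : (R * R) * n.-tuple (R * R)) :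
  behead_rv (cvec (tcons z : n.+1.-tuple (measurableTypeR R * measurableTypeR R)))
    = cvec z.2.
Proof. by apply/rowP => k; rewrite !mxE /tcons tnthS. Qed.

(** The bilinear form and |w|^2 are sums over coordinates, and the normalizing power of pi is a
    product over them, so the head coordinate splits off. *)
Lemma gexp_weighted_tcons n (a b : 'rV[C]_n.+1) z :
  gexp_weighted a b (tcons z) =
  plane_exp (a 0 0) (b 0 0) z.1 *
  gexp_weighted (behead_rv a) (behead_rv b) z.2.
Proof.
have h0 : cvec (tcons z) 0 0 = z.1.1 +i* z.1.2 :> C by rewrite mxE tnth0.
rewrite /gexp_weighted /plane_exp [RHS]mulrACA /gexp -cexpD.
congr (cexp _ * _).
  rewrite (dotp_recl _ a) (dotp_recl _ b) behead_conjv behead_cvec_tcons.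
  rewrite [conjv _ 0 0]mxE h0 /=; ring.
rewrite -rmorphM /=; congr (_%:C).
rewrite /gauss_density dotp_recl behead_conjv behead_cvec_tcons.
rewrite [conjv _ 0 0]mxE h0 mulrACA -expRD exprS invfM; congr (_ * expR _).
case: (dotp _ _) => u v /=; ring.
Qed.

(** Induction on the dimension, peeling off the first coordinate. Integrability is carried along
    with the value because Fubini consumes it. *)
Lemma gexp_weighted_int n (a b : 'rV[C]_n) :
  cintegrable (@dV R n) (gexp_weighted a b) /\
  cint (@dV R n) (gexp_weighted a b) = cexp (dotp a b).
Proof.
elim: n a b => [|n IH] a b.
  have dot0 (u w : 'rV[C]_0) : dotp u w = 0 by rewrite /dotp big_ord0.
  have w1 t : gexp_weighted a b t = 1.
    rewrite /gexp_weighted /gexp /gauss_density !dot0 addr0 cexp0 mul1r.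
    by rewrite oppr0 expR0 expr0 invr1 mulr1.
  (* In dimension 0 the measure is the Dirac mass at the empty tuple, so integration is evaluation
     there. *)
  have int_dV0 (f : 0.-tuple (measurableTypeR R * measurableTypeR R) -> \bar R) :
      measurable_fun setT f -> (\int[@dV R 0]_t f t)%E = f [tuple].
    move=> mf; rewrite (integral_dirac _ measurableT mf).
    by rewrite [X in (X * _)%E](_ : _ = 1%E) ?mul1e//; exact: diracT.
  have int0 (k : R) : (@dV R 0).-integrable setT (EFin \o cst k).
    apply/integrableP; split; first by apply/measurable_EFinP; exact: measurable_cst.
    rewrite int_dV0 ?ltry//=; exact: measurable_cst.
  rewrite dot0 cexp0 (funext w1); split; first by split; exact: int0.
  by rewrite /cint /Rintegral !int_dV0//=; exact: measurable_cst.
have [ig cg] := IH (behead_rv a) (behead_rv b).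
have pg := cintegrable_plane (a 0 0) (b 0 0).
have [mre mim] := cmeasurable_gexp_weighted a b.
have [ir ii] := cintegrable_prod pg ig.
have mt := @measurable_tcons _ (measurableTypeR R * measurableTypeR R)%type n.
move/measurable_EFinP in mre; move/measurable_EFinP in mim.
(* In dimension n + 1, [dV] is the image of a product measure under [tcons]: integrability is
   checked on the product and transported by change of variables. *)
have intr : (sprod (plane_lebesgue R) (@dV R n)).-integrable setT
    ((EFin \o (fun t => complex.Re (gexp_weighted a b t))) \o tcons).
  apply: eq_integrable ir => // z _.
  exact: esym (congr1 (fun w => (complex.Re w)%:E) (gexp_weighted_tcons a b z)).
have inti : (sprod (plane_lebesgue R) (@dV R n)).-integrable setT
    ((EFin \o (fun t => complex.Im (gexp_weighted a b t))) \o tcons).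
  apply: eq_integrable ii => // z _.
  exact: esym (congr1 (fun w => (complex.Im w)%:E) (gexp_weighted_tcons a b z)).
split.
  split; first exact: (integrable_pushforward mt mre).
  exact: (integrable_pushforward mt mim).
rewrite dotp_recl cexpD -cg -cint_plane -(cint_prod pg ig) /cint.
congr (_ +i* _).
  rewrite /Rintegral /dV /= (integral_pushforward mt mre)//.
  apply: congr1; apply: eq_integral => z _.
  exact: (congr1 (fun w => (complex.Re w)%:E) (gexp_weighted_tcons a b z)).
rewrite /Rintegral /dV /= (integral_pushforward mt mim)//.
apply: congr1; apply: eq_integral => z _.
exact: (congr1 (fun w => (complex.Im w)%:E) (gexp_weighted_tcons a b z)).
Qed.

End gaussian_space.

(** * Kernels are entire *)

Section cexp_entire.
Local Open Scope classical_set_scope.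
Local Open Scope ring_scope.
Context {R : realType}.
Local Notation C := R[i].

(** The estimate avoids division and so includes t = 0. This matters because it is applied to the
    real and imaginary parts of some nonzero h, one of which may vanish. *)
Lemma near0_derive_le (f : R -> R) (l e : R) : is_derive (0 : R) 1 f l -> 0 < e ->
  \forall t \near (0 : R), `|f t - f 0 - l * t| <= e * `|t|.
Proof.
move=> df e0; have [dv lE] := df.
have : (fun h => h^-1 *: ((f \o shift 0) (h *: 1) - f 0)) @ (0 : R)^' --> l.
  by rewrite -lE; exact: dv.
move/cvgrPdist_le => /(_ _ e0); rewrite near_withinE.
apply: filterS => t /= H.
have [->|t0] := eqVneq t 0; first by rewrite mulr0 subrr subr0 !normr0 mulr0.
have := H t0; rewrite /GRing.scale /= mulr1 addr0 => {}H.
rewrite -(ler_pM2l (x := `|t|^-1)) ?invr_gt0 ?normr_gt0//.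
rewrite mulrCA mulVf ?normr_eq0// mulr1 -normfV -normrM -normrN.
by rewrite mulrBr (mulrCA _ l) mulVf// mulr1 opprB.
Qed.

Lemma normc_le (z : C) :
  `|z| <= (`|complex.Re z| + `|complex.Im z|)%:C.
Proof.
case: z => x y /=; rewrite normc_def /= lecR.
rewrite -(ler_pXn2r (n := 2)) ?nnegrE ?sqrtr_ge0 ?addr_ge0//.
rewrite sqr_sqrtr ?addr_ge0 ?sqr_ge0// sqrrD !real_normK ?num_real//.
by rewrite lerD2r lerDl mulrn_wge0// mulr_ge0.
Qed.

(** The norm on [R[i]] takes its values in [R[i]]; the witness [r] carries estimates over to the
    order of [R]. *)
Lemma Re_Im_normc (z : C) :
  exists r : R, [/\ `|z| = r%:C, `|complex.Re z| <= r & `|complex.Im z| <= r].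
Proof.
case: z => x y /=; exists (Num.sqrt (x ^+ 2 + y ^+ 2)); split.
- by rewrite normc_def.
- by rewrite -sqrtr_sqr ler_wsqrtr// lerDl sqr_ge0.
- by rewrite -sqrtr_sqr ler_wsqrtr// lerDr sqr_ge0.
Qed.

(** The 6 counts error terms: as exp x <= 2, the real part costs e|x| + 2e|y| and the imaginary part
    2e|y| + e|y|, where |x| and |y| are at most |x + iy|. *)
Lemma cexp_sub1_le (e x y : R) : 0 <= e <= 1 -> `|y| <= 1 ->
  `|expR x - 1 - x| <= e * `|x| -> `|expR x - 1| <= e ->
  `|cos y - 1| <= e * `|y| -> `|sin y - y| <= e * `|y| ->
  `|cexp (x +i* y) - 1 - (x +i* y)| <= (6 * e)%:C * `|x +i* y|.
Proof.
move=> /andP[e0 e1] y1 ex ex1 cy sy.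
have [r [-> /= xr yr]] := Re_Im_normc (x +i* y).
apply: (le_trans (normc_le _)); rewrite -rmorphM lecR cexpE /=.
have E2 : expR x <= 2 by have := ler_norm (expR x - 1); lra.
have Ex0 := expR_ge0 x.
have -> : expR x * cos y - 1 - x = (expR x - 1 - x) + expR x * (cos y - 1) by ring.
have -> : expR x * sin y - 0 - y = expR x * (sin y - y) + (expR x - 1) * y by ring.
have h1 := ler_normD (expR x - 1 - x) (expR x * (cos y - 1)).
have h2 := ler_normD (expR x * (sin y - y)) ((expR x - 1) * y).
move: h1 h2; rewrite !normrM (ger0_norm Ex0) => h1 h2.
have b1 : expR x * `|cos y - 1| <= 2 * (e * `|y|).
  by apply: ler_pM.
have b2 : expR x * `|sin y - y| <= 2 * (e * `|y|) by apply: ler_pM.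
have b3 : `|expR x - 1| * `|y| <= e * `|y| by apply: ler_pM.
have b4 : e * `|x| <= e * r by apply: ler_wpM2l.
have b5 : e * `|y| <= e * r by apply: ler_wpM2l.
lra.
Qed.

Lemma cexp_sub1_cvg :
  (fun h : C^o => h^-1 * (cexp h - 1) : C^o) @ (0 : C^o)^' --> (1 : C^o).
Proof.
(* A positive element of [R[i]] has zero imaginary part, so the tolerance is the real number [e]. *)
apply/cvgrPdist_le => /= -[e e'] /=; rewrite ltcE /= => /andP[/eqP -> e0].
(* The quotient offsets the constant of [cexp_sub1_le]; the cap at 1 meets its hypothesis on the
   tolerance. *)
pose s := Num.min (e / 6) 1.
have s0 : 0 < s by rewrite /s lt_min ltr01 divr_gt0.
have s1 : s <= 1 by rewrite /s ge_min lexx orbT.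
have se : 6 * s <= e.
  have : s <= e / 6 by rewrite /s ge_min lexx.
  lra.
have n1 := near0_derive_le (is_derive_expR (0 : R)) s0.
have n2 := near0_derive_le (is_derive_cos (0 : R)) s0.
have n3 := near0_derive_le (is_derive_sin (0 : R)) s0.
have n4 : \forall t \near (0 : R), `|expR t - 1| <= s.
  have /cvgrPdist_le /(_ _ s0) := @continuous_expR R 0; rewrite expR0.
  by apply: filterS => t; rewrite distrC.
have n5 : \forall t \near (0 : R), `|t| <= 1.
  have := @cvg_id R (nbhs 0) => /cvgrPdist_le /(_ _ ltr01).
  by apply: filterS => t; rewrite sub0r normrN.
have := filterI (filterI n1 n2) (filterI n3 (filterI n4 n5)).
rewrite nbhs_ballP => -[dl /= dl0 H].
rewrite near_withinE; apply/nbhs_ballP; exists dl%:C; first by rewrite /= ltcR.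
move=> h; rewrite /ball /= sub0r normrN => hd h0.
have [r [hr xr yr]] := Re_Im_normc h.
move: hd; rewrite hr ltcR => rd.
(* Both coordinate projections send the complex disc of radius [dl] into the real interval of the
   same radius, where the five real estimates hold. *)
have xb : ball (0 : R) dl (complex.Re h).
  by rewrite /ball /= sub0r normrN (le_lt_trans xr).
have yb : ball (0 : R) dl (complex.Im h).
  by rewrite /ball /= sub0r normrN (le_lt_trans yr).
have [[+ _] [_ [+ _]]] := H _ xb.
have [[_ +] [+ [_ +]]] := H _ yb.
rewrite /= expR0 cos0 sin0 oppr0 mul0r !mul1r !subr0 addr0 => cc cs cy ce ce1.
have := @cexp_sub1_le s (complex.Re h) (complex.Im h).
have -> : complex.Re h +i* complex.Im h = h by case: (h).
have s01 : 0 <= s <= 1 by rewrite ltW.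
move=> /(_ s01 cy ce ce1 cc cs) le1.
have -> : 1 - h^-1 * (cexp h - 1) = - (h^-1 * (cexp h - 1 - h)).
  by field.
rewrite normrN normrM normfV ler_pdivrMl ?normr_gt0// mulrC.
apply: (le_trans le1); apply: ler_wpM2r => //.
by rewrite lecR.
Qed.

(** The functional equation exp(z + h) = exp(z) exp(h) transports the derivative at 0 to z. *)
Lemma differentiable_cexp (z : C) : differentiable (@cexp R : C^o -> C^o) (z : C^o).
Proof.
apply/derivable1_diffP; apply/cvg_ex; exists (cexp z).
rewrite [X in X @ _](_ : _ = fun h : C => cexp z * (h^-1 * (cexp h - 1))).
  rewrite -[X in _ --> X]mulr1; apply: cvgM; first exact: cvg_cst.
  exact: cexp_sub1_cvg.
apply/funext => h; rewrite /= cexpD /GRing.scale /= mulr1; ring.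
Qed.

Lemma entire_kernel n (a : 'rV[C]_n) : entire (Defs.kernel a).
Proof.
move=> z; apply: (@differentiable_comp _ _ C^o C^o (fun w => dotp w (conjv a)) (@cexp R)).
  rewrite (_ : (fun w => _) = \sum_(k < n)
      (fun w : 'rV[C]_n => w 0 k *: (conjv a 0 k : C^o))).
    apply: differentiable_sum => k; apply: differentiableZl.
    exact: differentiable_coord.
  by apply/funext => w; rewrite fct_sumE.
exact: differentiable_cexp.
Qed.

Lemma entire_kernel_span n (F : 'rV[C]_n -> C) : kernel_span F -> entire F.
Proof.
move=> [m [c [a ->]]] z.
rewrite (_ : (fun w => _) = \sum_(i < m) (c i *: (Defs.kernel (a i) : 'rV[C]_n -> C^o))).
  by apply: differentiable_sum => i; apply: differentiableZ; exact: entire_kernel.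
by apply/funext => w; rewrite fct_sumE.
Qed.

End cexp_entire.

(** * Toeplitz operators with exponential symbols *)

Section exponential_symbols.
Context {R : realType} {n : nat}.
Local Notation C := R[i].
Implicit Types a b u w z : 'rV[C]_n.

Lemma dotpC a b : dotp a b = dotp b a.
Proof. by apply: eq_bigr => k _; rewrite mulrC. Qed.

Lemma dotpDl a b w : dotp (a + b) w = dotp a w + dotp b w.
Proof. by rewrite /dotp -big_split; apply: eq_bigr => k _; rewrite mxE mulrDl. Qed.

Lemma dotpDr w a b : dotp w (a + b) = dotp w a + dotp w b.
Proof. by rewrite dotpC dotpDl !(dotpC w). Qed.

Lemma dotp0r a : dotp a 0 = 0.
Proof. by rewrite /dotp big1// => k _; rewrite mxE mulr0. Qed.

Lemma conjc_dotp a b : conjc (dotp a b) = dotp (conjv a) (conjv b).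
Proof. by rewrite /dotp rmorph_sum; apply: eq_bigr => k _; rewrite !mxE rmorphM. Qed.

Lemma conjvK a : conjv (conjv a) = a.
Proof. by apply/rowP => k; rewrite !mxE conjcK. Qed.

Lemma conjvD a b : conjv (a + b) = conjv a + conjv b.
Proof. by rewrite /conjv map_mxD. Qed.

Lemma gexpM a b a' b' w :
  gexp a b w * gexp a' b' w = gexp (a + a') (b + b') w.
Proof. by rewrite /gexp -cexpD !dotpDr; congr cexp; ring. Qed.

Lemma conjc_gexp a b w : conjc (gexp a b w) = gexp (conjv b) (conjv a) w.
Proof. by rewrite /gexp conjc_cexp rmorphD /= !conjc_dotp conjvK addrC. Qed.

Lemma kernelE a w : Defs.kernel a w = gexp (conjv a) 0 w.
Proof. by rewrite /Defs.kernel /gexp dotp0r addr0. Qed.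

Lemma mu_integralE (G : 'rV[C]_n -> C) :
  mu_integral G = cint (@dV R n) (fun t => G (cvec t) * (gauss_density (cvec t))%:C).
Proof.
rewrite /mu_integral /cint; congr (_ +i* _); apply: eq_Rintegral => t _.
  by rewrite ReM /= mulr0 mulr0 addr0.
by rewrite ImM /= mulr0 add0r.
Qed.

Section gexp_sum.
Variables (I : Type) (s : seq I) (c : I -> C) (a b : I -> 'rV[C]_n).
Local Notation G := (fun w => \sum_(i <- s) c i * gexp (a i) (b i) w).

Lemma gexp_sum_weighted t : G (cvec t) * (gauss_density (cvec t))%:C =
  \sum_(i <- s) c i * gexp_weighted (a i) (b i) t.
Proof. by rewrite mulr_suml; apply: eq_bigr => i _; rewrite /gexp_weighted mulrA. Qed.

Lemma cintegrable_gexp_sum :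
  cintegrable (@dV R n) (fun t => G (cvec t) * (gauss_density (cvec t))%:C).
Proof.
rewrite (funext gexp_sum_weighted).
by apply: cintegrable_sum => i; apply: cintegrableZ; exact: (gexp_weighted_int _ _).1.
Qed.

Lemma mu_integral_gexp_sum :
  mu_integral G = \sum_(i <- s) c i * cexp (dotp (a i) (b i)).
Proof.
rewrite mu_integralE (funext gexp_sum_weighted) cint_sum => [|i].
  apply: eq_bigr => i _.
  by rewrite cintZ ?(gexp_weighted_int _ _).2//; exact: (gexp_weighted_int _ _).1.
by apply: cintegrableZ; exact: (gexp_weighted_int _ _).1.
Qed.

End gexp_sum.

(* |G|^2 = G * conj G is again a combination of exponentials [gexp a b]. *)
Lemma L2mu_gexp_sum (I : Type) (s : seq I) (c : I -> C) (a b : I -> 'rV[C]_n) :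
  L2mu (fun w => \sum_(i <- s) c i * gexp (a i) (b i) w).
Proof.
set G := fun w => _.
have [mre mim] : cmeasurable (fun t => G (cvec t)).
  apply: cmeasurable_sum => i; apply: cmeasurableM; first exact: cmeasurable_cst.
  exact: cmeasurable_gexp.
split => //.
(* Indexing by pairs flattens the double sum for |G|^2 into a single combination, to which
   [cintegrable_gexp_sum] applies. *)
pose J := [seq (i, j) | i <- s, j <- s].
have GG w : G w * conjc (G w) = \sum_(p <- J) (c p.1 * conjc (c p.2)) *
    gexp (a p.1 + conjv (b p.2)) (b p.1 + conjv (a p.2)) w.
  rewrite big_allpairs_dep /= /G rmorph_sum mulr_suml.
  apply: eq_bigr => i _; rewrite mulr_sumr; apply: eq_bigr => j _.
  by rewrite rmorphM -gexpM -conjc_gexp /=; ring.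
have [iG _] := cintegrable_gexp_sum J (fun p => c p.1 * conjc (c p.2))
  (fun p => a p.1 + conjv (b p.2)) (fun p => b p.1 + conjv (a p.2)).
have := integrable_lty measurableT iG; congr (_ < _)%E.
apply: eq_integral => t _ /=; rewrite -GG.
by case: (G (cvec t)) => x y /=; congr EFin; ring.
Qed.

Lemma kernel_sumE m (c : 'I_m -> C) (a : 'I_m -> 'rV[C]_n) :
  (fun w => \sum_i c i * Defs.kernel (a i) w) =
  (fun w => \sum_i c i * gexp (conjv (a i)) 0 w).
Proof. by apply/funext => w; apply: eq_bigr => i _; rewrite kernelE. Qed.

Lemma fock_kernel_span (F : 'rV[C]_n -> C) : kernel_span F -> fock F.
Proof.
move=> FK; split; first exact: entire_kernel_span.
have [m [c [a ->]]] := FK; rewrite kernel_sumE; exact: L2mu_gexp_sum.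
Qed.

(** A symbol of this form times a kernel is again a multiple of an exponential, and the Gaussian
    weight makes these square integrable whatever their exponents. *)
Lemma toeplitz_dom_gexp (k : C) p q (F : 'rV[C]_n -> C) : kernel_span F ->
  toeplitz_dom (fun w => k * gexp p q w) F.
Proof.
move=> FK; split; first exact: fock_kernel_span.
have [m [c [a ->]]] := FK.
rewrite [X in L2mu X](_ : _ = fun w =>
  \sum_(i < m) (k * c i) * gexp (p + conjv (a i)) q w).
  exact: L2mu_gexp_sum.
apply/funext => w; rewrite mulr_sumr; apply: eq_bigr => i _.
by rewrite kernelE -[q in RHS]addr0 -gexpM; ring.
Qed.

(** The reproducing factor exp(z . conj w) is [gexp 0 z], so [z] joins [q] in the antiholomorphic
    exponent of a single exponential. *)
Lemma toeplitz_gexp (k : C) p q m (c : 'I_m -> C) (a : 'I_m -> 'rV[C]_n) :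
  toeplitz (fun w => k * gexp p q w) (fun w => \sum_i c i * Defs.kernel (a i) w) =
  fun z => \sum_i (k * c i) * cexp (dotp (p + conjv (a i)) (q + z)).
Proof.
rewrite kernel_sumE; apply/funext => z; rewrite /toeplitz /fock_proj.
rewrite -mu_integral_gexp_sum; congr mu_integral; apply/funext => w.
have -> : cexp (dotp z (conjv w)) = gexp 0 z w.
  by rewrite /gexp dotp0r add0r dotpC.
rewrite mulr_sumr mulr_suml; apply: eq_bigr => i _.
have -> : gexp (p + conjv (a i)) (q + z) w =
    gexp p q w * gexp (conjv (a i)) 0 w * gexp 0 z w.
  by rewrite !gexpM !addr0.
ring.
Qed.

End exponential_symbols.

Theorem proposition14 (R : realType) (n : nat) (n_ge1 : (1 <= n)%N) :
  let I1 : 'rV[R[i]]_n := const_mx 1 in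
  let v := fun z : 'rV[R[i]]_n => cexp (dotp (z + I1) I1) in
  let f := fun z : 'rV[R[i]]_n => cexp (dotp z I1) in
  let h := fun z : 'rV[R[i]]_n => cexp (dotp z I1 + dotp (conjv z) I1) in
  let vbar := fun z : 'rV[R[i]]_n => conjc (v z) in
  let fvbar := fun z : 'rV[R[i]]_n => f z * vbar z in
  [/\ (* T_f T_vbar and T_h are defined and agree on the span of the kernels *)
      forall F, kernel_span F ->
        [/\ toeplitz_dom vbar F,
            toeplitz_dom f (toeplitz vbar F),
            toeplitz_dom h F &
            toeplitz f (toeplitz vbar F) = toeplitz h F],
      (* T_fvbar is defined on the span of the kernels *)
      forall F, kernel_span F -> toeplitz_dom fvbar F &
      (* T_h and T_fvbar differ as operators on that span *)
      exists F, kernel_span F /\ toeplitz h F <> toeplitz fvbar F].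
Proof.
move=> I1 v f h vbar fvbar.
(* K is e^n; obtained from an existential, it stays an opaque scalar until the final comparison. *)
have [K KE] : exists K : R[i], K = cexp (dotp I1 I1) by eexists.
have I1E : conjv I1 = I1 by apply/rowP => k; rewrite !mxE conjc1.
have fE : f = fun w => 1 * gexp I1 0 w.
  by apply/funext => w; rewrite mul1r /gexp dotp0r addr0.
have hE : h = fun w => 1 * gexp I1 I1 w.
  by apply/funext => w; rewrite mul1r.
have vbarE : vbar = fun w => K * gexp 0 I1 w.
  apply/funext => w; rewrite /vbar /v conjc_cexp conjc_dotp I1E dotpC.
  rewrite KE /gexp dotp0r add0r -cexpD; congr cexp.
  by rewrite conjvD I1E dotpDr addrC (dotpC (conjv w)).
have fvbarE : fvbar = fun w => K * gexp I1 I1 w.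
  apply/funext => w; rewrite /fvbar fE vbarE mul1r mulrCA gexpM.
  by rewrite addr0 add0r.
split.
- move=> F FK; have [m [c [a FE]]] := FK.
  (* The coefficient K exp(conj a . I1) is the eigenvalue conj(v(a)). The image therefore stays in
     the kernel span, which places it in the domain of T_f. *)
  have TE : toeplitz vbar F = fun z =>
      \sum_i (K * c i * cexp (dotp (conjv (a i)) I1)) * Defs.kernel (a i) z.
    rewrite vbarE FE toeplitz_gexp; apply/funext => z; apply: eq_bigr => i _.
    by rewrite add0r dotpDr cexpD mulrA /Defs.kernel (dotpC z).
  split.
  + by rewrite vbarE; exact: toeplitz_dom_gexp.
  + by rewrite fE; apply: toeplitz_dom_gexp; rewrite TE; do 3 eexists.
  + by rewrite hE; exact: toeplitz_dom_gexp.
  + rewrite TE fE toeplitz_gexp hE FE toeplitz_gexp.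
    apply/funext => z; apply: eq_bigr => i _.
    (* On the T_h side, the term I1 . I1 of the expanded exponent produces the [K] that the other
       side owes to the shift in [v]. *)
    by rewrite add0r dotpDr !dotpDl !cexpD -KE; ring.
- by move=> F FK; rewrite fvbarE; exact: toeplitz_dom_gexp.
(* The witness is K_0, the constant 1; at z = 0 the two operators give e^n and e^(2n). *)
exists (fun w => \sum_(i < 1) 1 * Defs.kernel 0 w); split.
  by exists 1%N, (fun=> 1), (fun=> 0).
rewrite hE fvbarE !toeplitz_gexp => /(congr1 (fun G => G 0)) /=.
have conj0 : conjv (0 : 'rV[R[i]]_n) = 0 by apply/rowP => k; rewrite !mxE conjc0.
rewrite !big_ord1 conj0 !addr0 -KE !mulr1 mul1r => KK.
have {}KE : K = (expR n%:R)%:C.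
  rewrite KE; have -> : dotp I1 I1 = n%:R +i* 0.
    rewrite -[RHS]/((n%:R : R)%:C) rmorph_nat /dotp.
    under eq_bigr do rewrite !mxE mulr1.
    by rewrite sumr_const card_ord.
  by rewrite cexpE cos0 sin0 mulr1 mulr0.
move: KK; rewrite KE -rmorphM => /(congr1 (@complex.Re R)) /=.
(* Here n >= 1 enters: e^n > 1 rules out K = K^2. *)
have : 1 < expR n%:R :> R by rewrite expR_gt1 ltr0n.
by move=> e1 /eqP; rewrite lt_eqF// ltr_pMl// (lt_trans ltr01).
Qed.
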